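(* Let $n>8$ be an integer. Then $$\alpha(P(n,4)) = \begin{cases} \frac{7n}{8} & \text{if } n\equiv 0 \pmod 8,\\[2pt] \frac{7}{8}(n-1) & \text{if } n\equiv 1 \pmod 8,\\[2pt] \frac{7}{8}(n-2)+1 & \text{if } n\equiv 2 \pmod 8,\\[2pt] \frac{7}{8}(n-3)+2 & \text{if } n\equiv 3 \pmod 8,\\[2pt] \frac{7}{8}(n-5)+4 & \text{if } n\equiv 5 \pmod 8,\end{cases}$$ and $$\alpha(P(n,4)) \geq \begin{cases} \frac{7}{8}(n-4)+2 & \text{if } n\equiv 4 \pmod 8,\\[2pt] \frac{7}{8}(n-6)+4 & \text{if } n\equiv 6 \pmod 8,\\[2pt] \frac{7}{8}(n-7)+5 & \text{if } n\equiv 7 \pmod 8.\end{cases}$$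
   Context: For positive integers $n,k$ with $n>2k$, the generalized Petersen graph $P(n,k)$ is the graph with vertex set $\{u_i,v_i : i=1,\dots,n\}$ (so $2n$ vertices) and edge set $\{u_iu_{i+1},\ u_iv_i,\ v_iv_{i+k} : i=1,\dots,n\}$, subscripts being reduced modulo $n$. For a graph $G$, $\alpha(G)$ denotes the independence number, i.e. the size of a largest set of pairwise non-adjacent vertices. *)

(* Defs.v *)
From mathcomp Require Import all_boot all_order all_algebra.

Set Implicit Arguments.
Unset Strict Implicit.
Unset Printing Implicit Defensive.

Section IndependenceNumber.
Variables (T : finType) (e : rel T).

Definition independent (S : {set T}) : bool :=
  [forall x in S, forall y in S, ~~ e x y].

Definition independence_number : nat :=
  \max_(S : {set T} | independent S) #|S|.

End IndependenceNumber.

(* [inl i] is the outer vertex u_i and [inr i] the inner vertex v_i; the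
   subscripts, taken modulo n, are represented by 0, ..., n - 1. *)
Definition petersen_vertex (n : nat) : finType := ('I_n + 'I_n)%type.

(* The edges u_i u_(i+1), u_i v_i, v_i v_(i+k), each listed in one
   orientation only. *)
Definition petersen_arc (n k : nat) : rel (petersen_vertex n) :=
  fun x y => match x, y with
  | inl i, inl j => j == (i + 1) %% n :> nat
  | inl i, inr j => j == i
  | inr i, inr j => j == (i + k) %% n :> nat
  | inr _, inl _ => false
  end.

(* This is the generalized Petersen graph P(n,k) when 0 < k and 2k < n, in
   which case it has no loops. *)
Definition petersen (n k : nat) : rel (petersen_vertex n) :=
  fun x y => petersen_arc k x y || petersen_arc k y x.

Definition alphaP (n k : nat) : nat := independence_number (@petersen n k).

(* Main.v *)
(** A vertex set is read as a cyclic word of columns [i |-> (u_i in S, v_i in S)],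
    independence being a condition on windows of five consecutive columns.
    For the upper bound, give a column of weight [w] the excess [8 w - 7], and a
    window of four columns the largest total excess of a continuation of it.
    This potential is already attained by continuations of length at most 10;
    its changes telescope around the cycle, whence [8 |S| <= 7 n], and
    integrality of [alpha] gives the exact values.  For the lower bounds, one
    word of length [8 + r] for each [r < 8] is prolonged by copies of a word of
    length 8 and weight 7 beginning with the same four letters. *)
Require Import Defs.
From mathcomp Require Import all_boot all_order all_algebra.
From mathcomp Require Import zify lra.
Import GRing.Theory Num.Theory.

Definition column := (bool * bool)%type.

Definition weight (c : column) : nat := c.1 + c.2.

Definition blank : column := (false, false).
Definition outer : column := (true, false).
Definition inner : column := (false, true).
(** The pair [(true, true)] is excluded by the edge [u_i v_i]. *)
Definition columns : seq column := [:: blank; outer; inner].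

(* [c] may follow four columns of which the first is [p] and the last [t]. *)
Definition compatible (p t c : column) : bool :=
  ~~ (t.1 && c.1) && ~~ (p.2 && c.2).

(* Truncated subtraction accounts for the option of stopping with excess 0. *)
Fixpoint excess (k : nat) (p q r t : column) : nat :=
  if k is k'.+1 then
    foldr maxn 0 [seq 8 * weight c + excess k' q r t c - 7
                 | c <- columns & compatible p t c]
  else 0.

Lemma mem_columns (c : column) : ~~ (c.1 && c.2) -> c \in columns.
Proof. by case: c => [[] []]. Qed.

(** The recursion itself gives this with depth 11 on the right. Keeping depth 10 says that an
    eleventh column never raises the excess, which is checked on all 3^5 windows. *)
Lemma excess_step (p q r t c : column) :
  all (mem columns) [:: p; q; r; t; c] -> compatible p t c ->
  8 * weight c + excess 10 q r t c <= 7 + excess 10 p q r t.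
Proof.
have H : all (fun p => all (fun q => all (fun r => all (fun t => all (fun c =>
    compatible p t c ==>
      (8 * weight c + excess 10 q r t c <= 7 + excess 10 p q r t))
    columns) columns) columns) columns) columns by vm_compute.
move=> /and5P[hp hq hr ht /andP[hc _]].
move/allP/(_ _ hp)/allP/(_ _ hq)/allP/(_ _ hr)/allP/(_ _ ht): H.
by move=> /allP/(_ _ hc)/implyP.
Qed.

Lemma sum_cyclic_shift (f : nat -> nat) (n k : nat) :
  (forall i, f (n + i) = f i) -> \sum_(i < n) f (i + k) = \sum_(i < n) f i.
Proof.
move=> fn; elim: k => [|k IHk]; first by apply: eq_bigr => i _; rewrite addn0.
rewrite -IHk; apply: (@addnI (f (0 + k))).
have -> : \sum_(i < n) f (i + k.+1) = \sum_(i < n) f (lift ord0 i + k).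
  by apply: eq_bigr => i _; rewrite /bump /= addnS.
rewrite -(big_ord_recl n (fun i : 'I_n.+1 => f (i + k))) big_ord_recr /=.
by rewrite fn add0n addnC.
Qed.

Definition set_column {n : nat} (S : {set petersen_vertex n}) (i : 'I_n) :
    column :=
  (inl i \in S, inr i \in S).

Lemma card_columns (n : nat) (S : {set petersen_vertex n}) :
  #|S| = \sum_(i < n) weight (set_column S i).
Proof.
rewrite -sum1_card big_mkcond big_sumType /= -big_split /=.
by apply: eq_bigr => i _; rewrite /weight /=; case: (inl i \in S); case: (inr i \in S).
Qed.

Lemma alphaP_upper (n : nat) : 0 < n -> 8 * alphaP n 4 <= 7 * n.
Proof.
case: n => // n _; rewrite /alphaP /independence_number.
apply: (@big_ind _ (fun x => 8 * x <= 7 * n.+1)) => // [x y hx hy|S].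
  by rewrite /maxn; case: ifP.
move=> /forall_inP indS.
have ind x y : x \in S -> y \in S -> petersen 4 x y = false.
  by move=> xS yS; move/forall_inP: (indS x xS) => /(_ y yS)/negbTE.
(* Indices run over all naturals, so that windows cross the end of the cycle without a case
   distinction. *)
pose c i := set_column S (inord (i %% n.+1)).
have val_c i : (inord (i %% n.+1) : 'I_n.+1) = i %% n.+1 :> nat.
  by rewrite inordK // ltn_mod.
have c_mem i : c i \in columns.
  apply: mem_columns; apply/negP => /= /andP[h1 h2].
  by have := ind _ _ h1 h2; rewrite /petersen /= eqxx.
have c_compatible i : compatible (c i) (c (i + 3)) (c (i + 4)).
  apply/andP; split; apply/negP => /= /andP[h1 h2].
    by have := ind _ _ h1 h2; rewrite /petersen /= !val_c modnDml -addnA eqxx.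
  by have := ind _ _ h1 h2; rewrite /petersen /= !val_c modnDml eqxx.
have c_periodic i : c (n.+1 + i) = c i by rewrite /c modnDl.
pose E i := excess 10 (c i) (c (i + 1)) (c (i + 2)) (c (i + 3)).
have E_periodic i : E (n.+1 + i) = E i by rewrite /E -!addnA !c_periodic.
have cardS : #|S| = \sum_(i < n.+1) weight (c (i + 4)).
  rewrite (@sum_cyclic_shift (fun i => weight (c i))) => [|i].
    rewrite card_columns; apply: eq_bigr => i _; congr (weight (set_column S _)).
    by apply: val_inj; rewrite /= val_c modn_small.
  by rewrite c_periodic.
(* With the sum of [E] added to both sides, shifted by one on the left, the claim holds term by term
   by [excess_step]. *)
rewrite -(leq_add2r (\sum_(i < n.+1) E i)) -{1}(@sum_cyclic_shift E _ 1) //.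
rewrite cardS big_distrr /= -big_split.
rewrite mulnC -[in X in _ <= X * _ + _](card_ord n.+1) -sum_nat_const -big_split.
apply: leq_sum => i _; rewrite /E -!addnA.
by apply: excess_step; first rewrite /= !c_mem.
Qed.

Definition independent_at (c : nat -> column) (i : nat) : bool :=
  [&& ~~ ((c i).1 && (c i).2), ~~ ((c i).1 && (c i.+1).1)
    & ~~ ((c i).2 && (c (i + 4)).2)].

(** An edge reaches at most four columns ahead, so the edges across the seam are settled once
    columns [n, ..., n + 3] repeat the first four. *)
Lemma alphaP_lower (n : nat) (c : nat -> column) : 4 < n ->
  (forall i, independent_at c i) -> (forall j, j < 4 -> c (n + j) = c j) ->
  \sum_(i < n) weight (c i) <= alphaP n 4.
Proof.
move=> n_gt4 ind_c c_wrap.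
have c_mod i k : i < n -> k <= 4 -> c ((i + k) %% n) = c (i + k).
  move=> lt_in le_k; case: (ltnP (i + k) n) => [lt|ge]; first by rewrite modn_small.
  rewrite -(subnKC ge) modnDl modn_small ?c_wrap //; lia.
pose S : {set petersen_vertex n} :=
  [set x : 'I_n + 'I_n | match x with inl i => (c i).1 | inr i => (c i).2 end].
have -> : \sum_(i < n) weight (c i) = #|S|.
  rewrite card_columns; apply: eq_bigr => i _.
  by rewrite /set_column !inE; case: (c i).
have arcF x y : x \in S -> y \in S -> petersen_arc 4 x y = false.
  rewrite !inE; case: x y => i [] j //= hi hj; apply/negP => /eqP hij.
  - have /and3P[_ /negP[]] := ind_c i.
    by rewrite hi -addn1 -c_mod // -hij.
  - by have /and3P[/negP[]] := ind_c i; rewrite hi -hij.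
  - by have /and3P[_ _ /negP[]] := ind_c i; rewrite hi -c_mod // -hij.
apply: (@leq_bigmax_cond _ _ (fun S : {set _} => #|S|)).
apply/forall_inP => x xS; apply/forall_inP => y yS.
by rewrite /petersen !arcF.
Qed.

Definition block : seq column :=
  [:: outer; inner; outer; inner; inner; outer; inner; blank].

(** The word is infinite, so that one finite check covers every length [size B + 8 * m]. *)
Definition prolong (B : seq column) (i : nat) : column :=
  if i < size B then nth blank B i else nth blank block ((i - size B) %% 8).

Lemma prolong_periodic (B : seq column) (i m : nat) :
  size B <= i -> prolong B (i + 8 * m) = prolong B i.
Proof.
move=> le_Bi; rewrite /prolong !ltnNge le_Bi (leq_trans le_Bi (leq_addr _ _)) /=.
by rewrite -addnBAC // addnC mulnC modnMDl.
Qed.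

Lemma alphaP_ge (B : seq column) (m : nat) :
  4 < size B -> all (independent_at (prolong B)) (iota 0 (size B + 8)) ->
  take 4 B = take 4 block ->
  sumn (map weight B) + 7 * m <= alphaP (size B + 8 * m) 4.
Proof.
move=> B_gt4 /allP ind_B start_B.
have ind i : independent_at (prolong B) i.
  (* From [size B + 8] on, the window at [i] equals that at [i - 8], both lying in the periodic
     part. *)
  elim/ltn_ind: i => i IH; case: (ltnP i (size B + 8)) => [lt|ge].
    by apply: ind_B; rewrite mem_iota.
  have := IH (i - 8) ltac:(lia); rewrite /independent_at.
  rewrite -(prolong_periodic B (i - 8) 1); last by lia.
  rewrite -(prolong_periodic B (i - 8).+1 1); last by lia.
  rewrite -(prolong_periodic B (i - 8 + 4) 1); last by lia.
  have -> : i - 8 + 8 * 1 = i by lia.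
  have -> : (i - 8).+1 + 8 * 1 = i.+1 by lia.
  by have -> : i - 8 + 4 + 8 * 1 = i + 4 by lia.
apply: leq_trans (@alphaP_lower _ (prolong B) _ ind _); last 2 first.
- by lia.
(* Column [size B + 8 * m + j] is letter [j] of a fresh copy of [block], and [B] has the same letter
   there. *)
- move=> j j_lt4; rewrite addnAC prolong_periodic ?leq_addr //.
  rewrite /prolong -ltn_subRL subnn ltn0 addKn (leq_trans j_lt4 (ltnW B_gt4)).
  by rewrite -[RHS](nth_take _ j_lt4) start_B nth_take // modn_small //; lia.
rewrite -(big_mkord xpredT (weight \o prolong B)) /=.
elim: m => [|m IHm].
  rewrite !muln0 !addn0 sumnE big_map (big_nth blank).
  rewrite leq_eqVlt; apply/orP; left; apply/eqP.
  by apply: eq_big_nat => i /andP[_ lt_i]; rewrite /prolong lt_i.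
rewrite mulnSr addnA (leq_trans (leq_add IHm (leqnn 7))) //.
rewrite mulnSr addnA [leqRHS](@big_cat_nat _ _ _ (size B + 8 * m)) ?leq_addr //=.
rewrite leq_add2l -{1}[size B + _]add0n big_addn addKn.
rewrite (eq_bigr (fun i => weight (nth blank block (i %% 8)))) => [|i _].
  by rewrite unlock.
rewrite addnCA addnC addnAC prolong_periodic ?leq_addl //.
by rewrite /prolong ltnNge leq_addl addnK.
Qed.

(** Row [r] adds [4 + r] columns to the first four of [block]; row 0 gives [block] itself. *)
Definition start (r : nat) : seq column :=
  [:: outer; inner; outer; inner] ++ nth [::]
  [:: [:: inner; outer; inner; blank];
      [:: inner; outer; blank; outer; blank];
      [:: inner; outer; inner; outer; blank; blank];
      [:: inner; outer; inner; outer; blank; outer; blank];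
      [:: inner; outer; inner; outer; blank; outer; blank; blank];
      [:: inner; outer; inner; outer; blank; inner; outer; inner; blank];
      [:: inner; outer; inner; outer; blank; inner; outer; blank; outer;
          blank];
      [:: inner; outer; inner; outer; blank; inner; outer; inner; outer;
          blank; blank]] r.

Lemma alphaP_ge_mod (q r : nat) : 0 < q -> r < 8 ->
  7 * q + nth 0 [:: 0; 0; 1; 2; 2; 4; 4; 5] r <= alphaP (8 * q + r) 4.
Proof.
(* One of the [q] groups of eight columns is absorbed by [start r], which leaves [m] copies of
   [block]. *)
case: q => // m _ r_lt8.
have [sizeE weightE indE startE] : [/\ size (start r) = 8 + r,
    sumn (map weight (start r)) = 7 + nth 0 [:: 0; 0; 1; 2; 2; 4; 4; 5] r,
    all (independent_at (prolong (start r))) (iota 0 (size (start r) + 8))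
  & take 4 (start r) = take 4 block].
  by do 8 (case: r r_lt8 => [_ //|r r_lt8]).
have := @alphaP_ge (start r) m _ indE startE; rewrite sizeE weightE.
have -> : 8 * m.+1 + r = 8 + r + 8 * m by lia.
have -> a : 7 * m.+1 + a = 7 + a + 7 * m by lia.
by apply.
Qed.

Local Open Scope ring_scope.

Theorem proposition2 (n : nat) (hn : (8 < n)%N) :
  let a : rat := (alphaP n 4)%:R in
  let N : rat := n%:R in
  ((n = 0 %[mod 8])%N -> a = 7 * N / 8) /\
  ((n = 1 %[mod 8])%N -> a = 7 / 8 * (N - 1)) /\
  ((n = 2 %[mod 8])%N -> a = 7 / 8 * (N - 2) + 1) /\
  ((n = 3 %[mod 8])%N -> a = 7 / 8 * (N - 3) + 2) /\
  ((n = 5 %[mod 8])%N -> a = 7 / 8 * (N - 5) + 4) /\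
  ((n = 4 %[mod 8])%N -> 7 / 8 * (N - 4) + 2 <= a) /\
  ((n = 6 %[mod 8])%N -> 7 / 8 * (N - 6) + 4 <= a) /\
  ((n = 7 %[mod 8])%N -> 7 / 8 * (N - 7) + 5 <= a).
Proof.
move=> a N; rewrite {}/a {}/N.
have upper := @alphaP_upper n ltac:(lia).
have [q [r [q_gt0 r_lt8 nE]]] :
    exists q r, [/\ (0 < q)%N, (r < 8)%N & n = (8 * q + r)%N].
  by exists (n %/ 8)%N, (n %% 8)%N; split; lia.
have := alphaP_ge_mod q r q_gt0 r_lt8; rewrite -nE => lower.
move: (alphaP n 4) upper lower => A upper lower.
have lower_rat c : (7 * q + c <= A)%N -> 7 * q%:R + c%:R <= A%:R :> rat.
  by rewrite -(ler_nat rat) natrD natrM.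
(* For [r] = 0, 1, 2, 3, 5 the constant of the lower bound is the integer part of 7r/8, so the upper
   bound forces equality. For 4, 6, 7 it is one less. *)
have exact_rat c : (A < 7 * q + c.+1)%N -> (7 * q + c <= A)%N ->
    A%:R = 7 * q%:R + c%:R :> rat.
  by rewrite addnS ltnS => le ge; rewrite -natrM -natrD; congr _%:R; lia.
have n_rat : n%:R = 8 * q%:R + r%:R :> rat by rewrite nE natrD natrM.
have rE k : (k < 8)%N -> (n = k %[mod 8])%N -> r = k by lia.
do ![split]; move=> /rE => /(_ isT) r_eq; move: lower; rewrite n_rat r_eq /=.
- by move=> /exact_rat ->; [lra | lia].
- by move=> /exact_rat ->; [lra | lia].
- by move=> /exact_rat ->; [lra | lia].
- by move=> /exact_rat ->; [lra | lia].
- by move=> /exact_rat ->; [lra | lia].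
- by move=> /lower_rat; lra.
- by move=> /lower_rat; lra.
- by move=> /lower_rat; lra.
Qed.
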